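(* Let $H$ be a bipartite graph. If $n$ is even and sufficiently large, then $\mathrm{rex}(n,H,K_3)=\mathcal{N}(H,T(n,2))$. If $H$ is a tree and $n$ is odd and sufficiently large, then $\mathrm{rex}(n,H,K_3)=\mathcal{N}(H,G^* )$, where $G^*$ is a (suitable) regular graph obtained by deleting some edges of an $n$-vertex blow-up of $C_5$.
   Context: All graphs are finite and simple. $\mathcal{N}(H,G)$ denotes the number of (not necessarily induced) copies of $H$ in $G$. A graph is $F$-free if it does not contain $F$ as a (not necessarily induced) subgraph. For graphs $H,F$ and a positive integer $n$, $\mathrm{rex}(n,H,F):=\max\{\mathcal{N}(H,G): G \text{ is an } F\text{-free regular } n\text{-vertex graph}\}$. $T(n,2)$ is the complete bipartite graph on $n$ vertices with parts of order $\lfloor n/2\rfloor$ and $\lceil n/2\rceil$. $C_5$ is the cycle on 5 vertices. A blow-up of a graph $Q$ is a graph obtained by replacing each vertex of $Q$ by an independent set of vertices (not necessarily of equal sizes) and each edge $uv\in E(Q)$ by a complete bipartite graph between the independent sets replacing $u$ and $v$. ''Sufficiently large'' means larger than some constant depending on $H$. The second statement asserts that there exists such a graph $G^*$ on $n$ vertices attaining the maximum. *)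

(* Defs.v *)
From HB Require Import structures.
From mathcomp Require Import all_boot.

Set Implicit Arguments.
Unset Strict Implicit.
Unset Printing Implicit Defensive.

Record sgraph (V : finType) := SGraph {
  edges : {set {set V}};
  _ : [forall e in edges, #|e| == 2]
}.

HB.instance Definition _ (V : finType) := [isSub for @edges V].
HB.instance Definition _ (V : finType) := [Finite of sgraph V by <:].

Definition adj (V : finType) (G : sgraph V) : rel V :=
  fun x y => [set x; y] \in edges G.

Fact graph_of_rel_subproof (V : finType) (r : rel V) :
  [forall e in [set [set p.1; p.2] | p : V * V & (p.1 != p.2) && r p.1 p.2],
     #|e : {set V}| == 2].
Proof.
apply/forall_inP => e /imsetP[[x y]]; rewrite inE => /andP[/= nxy _] ->.
by rewrite cards2 nxy.
Qed.

(* x and y are adjacent iff x != y and (r x y or r y x) *)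
Definition graph_of_rel (V : finType) (r : rel V) : sgraph V :=
  SGraph (graph_of_rel_subproof r).

Definition complete_graph (n : nat) : sgraph 'I_n :=
  graph_of_rel (fun i j : 'I_n => i != j).

(* the cycle C_n for n >= 3; ordS is the successor modulo n *)
Definition cycle_graph (n : nat) : sgraph 'I_n :=
  graph_of_rel (fun i j : 'I_n => j == ordS i).

(* T(n,2): the parts are {i | i < n./2} and {i | n./2 <= i} *)
Definition turan2 (n : nat) : sgraph 'I_n :=
  graph_of_rel (fun i j : 'I_n => (i < n./2) && (n./2 <= j)).

Definition degree (V : finType) (G : sgraph V) (x : V) : nat :=
  #|[set y | adj G x y]|.

Definition regular (V : finType) (G : sgraph V) : bool :=
  [forall x, forall y, degree G x == degree G y].

Definition bipartite (V : finType) (G : sgraph V) : Prop :=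
  exists A : {set V}, forall x y, adj G x y -> (x \in A) != (y \in A).

Definition connected (V : finType) (G : sgraph V) : Prop :=
  0 < #|V| /\ forall x y, connect (adj G) x y.

Definition acyclic (V : finType) (G : sgraph V) : Prop :=
  forall s : seq V, 2 < size s -> ~ ucycle (adj G) s.

Definition tree (V : finType) (G : sgraph V) : Prop :=
  connected G /\ acyclic G.

(* A subgraph on V is a pair K = (vertex set, edge set), so that isolated
   vertices of H are recorded; [is_copy H K] says that K is isomorphic to H. *)
Definition is_copy (U V : finType) (H : sgraph U)
    (K : {set V} * {set {set V}}) : bool :=
  [exists f : {ffun U -> V},
     [&& injectiveb f,
         K.1 == [set f x | x : U]
       & K.2 == [set f @: e | e : {set U} in edges H]]].

(* the (not necessarily induced) copies of H in G *)
Definition copies (U V : finType) (H : sgraph U) (G : sgraph V) :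
    {set {set V} * {set {set V}}} :=
  [set K : {set V} * {set {set V}} | (K.2 \subset edges G) && is_copy H K].

Definition ncopies (U V : finType) (H : sgraph U) (G : sgraph V) : nat :=
  #|copies H G|.

Definition graph_free (W V : finType) (F : sgraph W) (G : sgraph V) : bool :=
  copies F G == set0.

(* The maximum over the empty family would be 0; this does not occur as soon as
   F has an edge, since the edgeless graph is then regular and F-free. *)
Definition rex (n : nat) (U W : finType) (H : sgraph U) (F : sgraph W) : nat :=
  \max_(G : sgraph 'I_n | graph_free F G && regular G) ncopies H G.

(* The fibres of p are the independent sets replacing the vertices of Q; they
   are nonempty. *)
Definition is_blowup (U V : finType) (Q : sgraph U) (B : sgraph V) : Prop :=
  exists p : V -> U,
    (forall u, exists x, p x = u) /\
    (forall x y, adj B x y = adj Q (p x) (p y)).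

(* Main.v *)
Require Import Defs.
From mathcomp Require Import all_boot.
From mathcomp Require Import zify.

(* Let k be the order of H. The copies of H correspond to the embeddings of H up
   to automorphisms, and all but O(n^(k-1)) of the homomorphisms from H to an
   n-vertex graph are embeddings.

   A triangle-free d-regular graph with d > 2n/5 is bipartite (Andrasfai), so its
   two sides have order n/2 and it is a subgraph of T(n,2). If d <= 2n/5 and H has
   an edge, then the number of homomorphisms from H is smaller than for T(n,2) by
   a constant factor.

   If n is odd, a regular graph with an edge is not bipartite, hence d <= 2n/5.
   For a tree H there are exactly n d^(k-1) homomorphisms, so an extremal graph
   has d close to 2n/5, because a regular triangle-free graph of such a degree
   exists. It then contains a closed 5-walk, all but few of its vertices are
   adjacent to two vertices of this walk, and this classification extends to a
   surjective homomorphism onto C5: the extremal graph itself is G*. *)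

Set Implicit Arguments.
Unset Strict Implicit.
Unset Printing Implicit Defensive.

(** * Copies and embeddings *)

Section Adjacency.
Variables (V : finType) (G : sgraph V).

Lemma adjC x y : adj G x y = adj G y x.
Proof. by rewrite /adj setUC. Qed.

Lemma card_edge e : e \in edges G -> #|e| = 2.
Proof. by case: G => E /= /forall_inP h /h /eqP. Qed.

Lemma adjxx x : adj G x x = false.
Proof.
apply/negP => /card_edge; by rewrite setUid cards1.
Qed.

Lemma adj_neq x y : adj G x y -> x != y.
Proof. by apply: contraTneq => ->; rewrite adjxx. Qed.

Lemma edge_adj e : e \in edges G -> exists x y, e = [set x; y] /\ adj G x y.
Proof.
move=> eG; have /eqP/cards2P[x [y [_ exy]]] := card_edge eG.
by exists x, y; rewrite /adj -exy.
Qed.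

End Adjacency.

Lemma adj_graph_of_rel (V : finType) (r : rel V) x y :
  adj (graph_of_rel r) x y = (x != y) && (r x y || r y x).
Proof.
apply/imsetP/idP => [[[a b]] | /andP[nxy /orP[rxy|ryx]]].
- rewrite inE /= => /andP[nab rab] e.
  have nxy : x != y.
    by have := cards2 a b; rewrite -e cards2 nab; case: (x != y).
  have: x \in [set a; b] by rewrite -e set21.
  have: y \in [set a; b] by rewrite -e set22.
  rewrite nxy !inE => /orP[]/eqP ey /orP[]/eqP ex; move: nxy rab;
    by rewrite ex ey ?eqxx // => _ ->; rewrite ?orbT.
- by exists (x, y); rewrite ?inE /= ?nxy.
- by exists (y, x); rewrite ?inE /= 1?eq_sym ?nxy // setUC.
Qed.

Lemma edges_subset (V : finType) (G B : sgraph V) :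
  (forall x y, adj G x y -> adj B x y) -> edges G \subset edges B.
Proof.
move=> sGB; apply/subsetP => e /edge_adj[x [y [-> ]]]; exact: sGB.
Qed.

Section Embeddings.
Variables (U V : finType) (H : sgraph U).

Definition homs (G : sgraph V) : {set {ffun U -> V}} :=
  [set f : {ffun U -> V} |
    [forall x, forall y, adj H x y ==> adj G (f x) (f y)]].

Definition embeddings (G : sgraph V) : {set {ffun U -> V}} :=
  [set f in homs G | injectiveb f].

Definition image_copy (f : {ffun U -> V}) : {set V} * {set {set V}} :=
  ([set f x | x : U], [set f @: (e : {set U}) | e in edges H]).

Lemma homsP G (f : {ffun U -> V}) :
  reflect (forall x y, adj H x y -> adj G (f x) (f y)) (f \in homs G).
Proof.
rewrite inE; apply: (iffP forallP) => [h x y|h x].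
  by move/forallP: (h x) => /(_ y)/implyP.
by apply/forallP => y; apply/implyP/h.
Qed.

Lemma homs_edges G (f : {ffun U -> V}) :
  (f \in homs G) = ((image_copy f).2 \subset edges G).
Proof.
apply/homsP/subsetP => [h e' /imsetP[e /edge_adj[x [y [-> axy]]] ->]|h x y axy].
  rewrite imsetU1 imset_set1; exact: h.
rewrite /adj -[[set f y]]imset_set1 -imsetU1; apply: h.
by apply/imsetP; exists [set x; y].
Qed.

Lemma copies_imset G : copies H G = image_copy @: embeddings G.
Proof.
apply/setP => K; rewrite inE; apply/andP/imsetP.
  case=> sKG /existsP[f /and3P[injf /eqP K1 /eqP K2]].
  have eK : K = image_copy f by rewrite [LHS]surjective_pairing K1 K2.
  by exists f => //; rewrite inE injf homs_edges -eK sKG.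
case=> f; rewrite inE homs_edges => /andP[sfG injf] ->.
split=> //; apply/existsP; exists f.
by rewrite injf /= !eqxx.
Qed.

End Embeddings.

Definition automorphisms (U : finType) (H : sgraph U) : {set {ffun U -> U}} :=
  [set g : {ffun U -> U} | injectiveb g &
     [set g @: (e : {set U}) | e in edges H] == edges H].

Lemma automorphisms_gt0 (U : finType) (H : sgraph U) : 0 < #|automorphisms H|.
Proof.
apply/card_gt0P; exists [ffun x => x]; rewrite inE.
have e0 (A : {set U}) : [ffun x => x] @: A = A.
  by rewrite -[RHS]imset_id; apply: eq_imset => x; rewrite ffunE.
apply/andP; split; first by apply/injectiveP => x y; rewrite !ffunE.
rewrite -[X in _ == X]imset_id; apply/eqP; exact: eq_imset.
Qed.

Lemma imset_inj (aT rT : finType) (f : aT -> rT) :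
  injective f -> injective (fun A : {set aT} => f @: A).
Proof.
move=> injf A B eAB; apply/setP => x.
by rewrite -(mem_imset A x injf) -(mem_imset B x injf) eAB.
Qed.

(** The fibre of [image_copy] over the copy given by [f0] consists of the composites of [f0] with an
    automorphism, so all fibres have the same size. *)
Lemma ncopies_automorphisms (U V : finType) (H : sgraph U) (G : sgraph V) :
  ncopies H G * #|automorphisms H| = #|embeddings H G|.
Proof.
rewrite -[RHS]sum1_card (partition_big (@image_copy U V H) (mem (copies H G)));
  last by move=> f fE; rewrite copies_imset; apply: imset_f.
rewrite /ncopies -sum_nat_const; apply: eq_bigr => K.
rewrite copies_imset => /imsetP[f0 f0E ->].
move: (f0E); rewrite inE => /andP[f0h /injectiveP injf0].
have comp_inj : injective (fun g : {ffun U -> U} => [ffun x => f0 (g x)]).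
  by move=> g h /ffunP e; apply/ffunP => x; move: (e x); rewrite !ffunE => /injf0.
rewrite sum1dep_card -(card_imset _ comp_inj); apply: eq_card => f.
apply/imsetP/idP => [[g]|].
  rewrite [_ \in automorphisms H]inE => /andP[/injectiveP injg /eqP gE] ->.
  have e2 : image_copy H [ffun x => f0 (g x)] = image_copy H f0.
    congr (_, _).
      apply/setP => y; apply/imsetP/imsetP => [[x _ ->]|[x _ ->]].
        by rewrite ffunE; exists (g x).
      have [g' _ gK] := injF_bij injg.
      by exists (g' x); rewrite // ffunE gK.
    rewrite -{2}gE -imset_comp; apply: eq_imset => e /=.
    by rewrite -imset_comp; apply: eq_imset => x /=; rewrite ffunE.
  rewrite inE e2 eqxx andbT inE homs_edges e2 -homs_edges f0h /=.
  by apply/injectiveP => x y; rewrite !ffunE => /injf0/injg.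
rewrite inE => /andP[]; rewrite inE => /andP[_ /injectiveP injf] /eqP[e1 e2].
(* [f] and [f0] have the same image, so [f] factors through [f0]; the factor is the required
   automorphism. *)
have ex x : exists y, f x == f0 y.
  have: f x \in [set f0 x | x : U] by rewrite -e1 imset_f.
  by case/imsetP => y _ ->; exists y.
have fE x := eqP (xchooseP (ex x)).
have [g fg] : exists g : {ffun U -> U}, f = [ffun x => f0 (g x)].
  by exists [ffun x => xchoose (ex x)]; apply/ffunP => x; rewrite !ffunE.
exists g => //; rewrite inE; apply/andP; split.
  by apply/injectiveP => x y e; apply: injf; rewrite fg !ffunE e.
apply/eqP/(imset_inj (imset_inj injf0)); rewrite -e2 -imset_comp.
apply: eq_imset => e /=; rewrite -imset_comp fg.
by apply: eq_imset => x /=; rewrite ffunE.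
Qed.

(** The number of automorphisms does not depend on the host graph, so hosts can be compared through
    embeddings. *)
Lemma leq_ncopies (U V W : finType) (H : sgraph U) (G : sgraph V)
    (G' : sgraph W) :
  (ncopies H G <= ncopies H G') = (#|embeddings H G| <= #|embeddings H G'|).
Proof.
by rewrite -!ncopies_automorphisms leq_pmul2r // automorphisms_gt0.
Qed.

Definition triangle_free (V : finType) (G : sgraph V) : Prop :=
  forall x y z, adj G x y -> adj G y z -> ~~ adj G x z.

Lemma graph_free_K3P (V : finType) (G : sgraph V) :
  graph_free (complete_graph 3) G <-> triangle_free G.
Proof.
rewrite /graph_free copies_imset imset_eq0; split.
  move/eqP => e x y z axy ayz; apply/negP => axz.
  pose f := [ffun i : 'I_3 => nth x [:: x; y; z] i].
  suff: f \in embeddings (complete_graph 3) G by rewrite e inE.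
  have fh : f \in homs (complete_graph 3) G.
    apply/homsP => i j; rewrite adj_graph_of_rel !ffunE.
    by case: i j => [[|[|[|//]]] ?] [[|[|[|//]]] ?]; rewrite //= adjC.
  rewrite inE fh /=; apply/injectiveP => i j eij.
  apply/eqP/negPn/negP => nij; move/homsP: fh => /(_ i j).
  by rewrite eij adjxx adj_graph_of_rel nij /=; apply/implyP.
move=> tf; apply/eqP/setP => f; rewrite !inE; apply/negP => /andP[+ _].
have := homsP (complete_graph 3) G f; rewrite inE => h /h {}h.
pose o (i : nat) (lt_i : i < 3) := Ordinal lt_i.
have adjo i j li lj : i != j -> adj G (f (@o i li)) (f (@o j lj)).
  by move=> nij; apply: h; rewrite adj_graph_of_rel -val_eqE /= nij.
by have := tf _ _ _ (adjo 0 1 isT isT isT) (adjo 1 2 isT isT isT); rewrite adjo.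
Qed.

(** * Counting homomorphisms *)

Section PartialHoms.
Variables (U V : finType) (H : sgraph U) (G : sgraph V).
Implicit Types (S : {set U}) (f g : {ffun U -> V}).

(** Values outside [S] are free: each vertex outside [S] contributes a factor [#|V|], and all stages
    of an induction on [S] live in one function type. *)
Definition partial_homs S : {set {ffun U -> V}} :=
  [set f : {ffun U -> V} | [forall x in S, forall y in S,
     adj H x y ==> adj G (f x) (f y)]].

Definition extensions S u f : {set V} :=
  [set v | [forall y in S, adj H u y ==> adj G v (f y)]].

Definition update u f v : {ffun U -> V} :=
  [ffun x => if x == u then v else f x].

Lemma partial_homsP S f :
  reflect {in S &, forall x y, adj H x y -> adj G (f x) (f y)}
          (f \in partial_homs S).
Proof.
rewrite inE; apply: (iffP forall_inP) => [h x y xS yS|h x xS].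
  by move/forall_inP: (h x xS) => /(_ y yS)/implyP.
by apply/forall_inP => y yS; apply/implyP/h.
Qed.

Lemma extensionsP S u f v :
  reflect {in S, forall y, adj H u y -> adj G v (f y)}
          (v \in extensions S u f).
Proof.
rewrite inE; apply: (iffP forall_inP) => h y yS; first exact/implyP/h.
exact/implyP/h.
Qed.

Lemma partial_homsT : partial_homs setT = homs H G.
Proof.
apply/setP => f; apply/partial_homsP/homsP => h x y; last by move=> _ _; exact: h.
by apply: h; rewrite inE.
Qed.

Lemma partial_homs_small S : #|S| <= 1 -> #|partial_homs S| = #|V| ^ #|U|.
Proof.
move=> /card_le1_eqP S1; rewrite -card_ffun -cardsT; apply: eq_card => f.
rewrite [RHS]inE; apply/partial_homsP => x y xS yS.
by rewrite (S1 x y) // adjxx.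
Qed.

Lemma partial_homsU1_sub S u : #|partial_homs (u |: S)| <= #|partial_homs S|.
Proof.
apply/subset_leq_card/subsetP => f /partial_homsP h.
by apply/partial_homsP => x y xS yS; apply: h; rewrite inE ?xS ?yS orbT.
Qed.

Lemma update_partial_homs S u f v : u \notin S ->
  (update u f v \in partial_homs (u |: S)) =
  (f \in partial_homs S) && (v \in extensions S u f).
Proof.
move=> uS.
have nu x : x \in S -> (x == u) = false.
  by move=> xS; apply/negP => /eqP e; rewrite -e xS in uS.
apply/partial_homsP/andP => [h|[/partial_homsP h1 /extensionsP h2]].
  split; [apply/partial_homsP => x y xS yS | apply/extensionsP => y yS].
    have := h x y (setU1r _ xS) (setU1r _ yS).
    by rewrite !ffunE !nu.
  have := h u y (setU11 _ _) (setU1r _ yS).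
  by rewrite !ffunE eqxx nu.
move=> x y /setU1P[->|xS] /setU1P[->|yS]; rewrite !ffunE ?eqxx ?nu ?adjxx //.
- exact: h2.
- by rewrite adjC [adj G _ _]adjC; apply: h2.
- exact: h1.
Qed.

(* Swapping the value at [u] with the spare one is an involution on pairs. *)
Lemma card_partial_homsU1 S u : u \notin S ->
  #|V| * #|partial_homs (u |: S)| =
  \sum_(f in partial_homs S) #|extensions S u f|.
Proof.
move=> uS; pose swap (p : {ffun U -> V} * V) := (update u p.1 p.2, p.1 u).
have swapK : involutive swap.
  case=> f v; congr (_, _); last by rewrite ffunE eqxx.
  by apply/ffunP => x; rewrite !ffunE; case: eqP => [->|].
rewrite mulnC -[#|V|]cardsT -cardsX.
rewrite -(on_card_preimset (f := swap)); last exact/onW_bij/inv_bij.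
under eq_bigr do rewrite -sum1_card.
rewrite pair_big_dep /= sum1dep_card; apply: eq_card => -[f v].
by rewrite [LHS]inE in_setX in_setT andbT /= update_partial_homs // [RHS]inE.
Qed.

Lemma leq_card_partial_homsU1 S u y d : u \notin S -> y \in S -> adj H u y ->
  (forall x, degree G x <= d) ->
  #|V| * #|partial_homs (u |: S)| <= d * #|partial_homs S|.
Proof.
move=> uS yS uy degG; rewrite card_partial_homsU1 // mulnC -sum_nat_const.
apply: leq_sum => f _; apply: leq_trans (degG (f y)).
apply/subset_leq_card/subsetP => v /extensionsP/(_ y yS uy).
by rewrite inE adjC.
Qed.

(** As [y] is the only neighbour of [u] in [S], the admissible values at [u] are exactly the
    neighbours of [f y]. *)
Lemma eq_card_partial_homsU1 S u y d : u \notin S -> y \in S -> adj H u y ->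
  {in S, forall z, adj H u z -> z = y} ->
  (forall x, degree G x = d) ->
  #|V| * #|partial_homs (u |: S)| = d * #|partial_homs S|.
Proof.
move=> uS yS uy uniq_y degG; rewrite card_partial_homsU1 // mulnC -sum_nat_const.
apply: eq_bigr => f _; rewrite -(degG (f y)); apply: eq_card => v.
rewrite [RHS]inE adjC; apply/extensionsP/idP => [/(_ y yS uy)//|vy z zS uz].
by rewrite (uniq_y z).
Qed.

End PartialHoms.

(** If [f] agrees at [x] and [y], its value at [x] can be recovered from [y], so overwriting it by a
    free value loses nothing. A collision thus saves a factor [#|V|], for each of the [#|U| ^ 2]
    pairs. *)
Lemma card_not_injective (U V : finType) :
  #|V| * #|[set f : {ffun U -> V} | ~~ injectiveb f]| <= #|U| ^ 2 * #|V| ^ #|U|.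
Proof.
have sub : [set f : {ffun U -> V} | ~~ injectiveb f] \subset
    \bigcup_(p : U * U) [set f : {ffun U -> V} | p.1 != p.2 & f p.1 == f p.2].
  apply/subsetP => f; rewrite inE => /injectivePn[x [y nxy fxy]].
  by apply/bigcupP; exists (x, y); rewrite // inE /= nxy fxy eqxx.
have coll (p : U * U) : #|V| * #|[set f : {ffun U -> V} | p.1 != p.2 & f p.1 == f p.2]|
    <= #|V| ^ #|U|.
  case: p => x y /=; rewrite mulnC -[#|V| in X in X <= _]cardsT -cardsX -card_ffun.
  rewrite -[X in _ <= X]cardsT.
  rewrite -(card_in_imset (f := fun p => update x p.1 p.2)); first exact/subset_leq_card/subsetT.
  move=> [f v] [g w]; rewrite !inE !andbT /= => /andP[nxy /eqP fxy] /andP[_ /eqP gxy] /ffunP e.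
  have e' z : z != x -> f z = g z by move=> /negPf nz; have := e z; rewrite !ffunE nz.
  congr (_, _); last by have := e x; rewrite !ffunE eqxx.
  apply/ffunP => z; case: (eqVneq z x) => [->|]; last exact: e'.
  by rewrite fxy gxy e' // eq_sym.
apply: leq_trans (leq_mul (leqnn _) (subset_leq_card sub)) _.
apply: (@leq_trans (\sum_(p : U * U) #|V| ^ #|U|)); last first.
  by rewrite sum_nat_const card_prod mulnn.
apply: (@leq_trans (#|V| * \sum_(p : U * U) #|[set f : {ffun U -> V} | p.1 != p.2 & f p.1 == f p.2]|)).
  rewrite leq_mul2l; apply/orP; right.
  elim/big_rec2: _ => [|p m A _ le_Am]; first by rewrite cards0.
  by apply: leq_trans (leq_card_setU _ _) _; rewrite leq_add2l.
by rewrite big_distrr; apply: leq_sum => p _; apply: coll.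
Qed.

Lemma leq_homs_embeddings (U V : finType) (H : sgraph U) (G : sgraph V) :
  #|V| * #|homs H G| <=
  #|V| * #|embeddings H G| + #|U| ^ 2 * #|V| ^ #|U|.
Proof.
apply: (@leq_trans (#|V| * (#|embeddings H G| +
    #|[set f : {ffun U -> V} | ~~ injectiveb f]|))).
  rewrite leq_mul2l; apply/orP; right.
  apply: leq_trans (leq_card_setU _ _); apply/subset_leq_card/subsetP => f fh.
  rewrite in_setU; case: (boolP (injectiveb f)) => injf; apply/orP.
    by left; rewrite inE fh.
  by right; rewrite inE.
by rewrite mulnDr leq_add2l card_not_injective.
Qed.

(** * Proper 2-colourings *)

Section Colourings.
Variables (U : finType) (H : sgraph U).
Implicit Types S : {set U}.

Definition colourings : {set {ffun U -> bool}} :=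
  [set h : {ffun U -> bool} | [forall x, forall y, adj H x y ==> (h x != h y)]].

Lemma colouringsP (h : {ffun U -> bool}) :
  reflect (forall x y, adj H x y -> h x != h y) (h \in colourings).
Proof.
rewrite inE; apply: (iffP forallP) => [a x y|a x].
  by move/forallP: (a x) => /(_ y)/implyP.
by apply/forallP => y; apply/implyP/a.
Qed.

(** For bipartite [H] these are all maps when [S] is empty and the proper colourings when [S] is
    full. Growing [S] vertex by vertex bounds the number of colourings from below. *)
Definition precolourings (S : {set U}) : {set {ffun U -> bool}} :=
  [set g : {ffun U -> bool} |
    [exists h in colourings, [forall x in S, h x == g x]]].

Lemma precolouringsP S (g : {ffun U -> bool}) :
  reflect (exists2 h, h \in colourings & {in S, h =1 g})
          (g \in precolourings S).
Proof.
rewrite inE; apply: (iffP exists_inP) => -[h hc e]; exists h => //.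
  by move=> x xS; apply/eqP/(forall_inP e).
by apply/forall_inP => x xS; rewrite e.
Qed.

Lemma precolouringsT : precolourings setT = colourings.
Proof.
apply/setP => g; apply/precolouringsP/idP => [[h hc e]|gc]; last by exists g.
by have -> : g = h by apply/ffunP => x; rewrite e ?inE.
Qed.

Lemma precolourings0 : bipartite H -> precolourings set0 = setT.
Proof.
case=> A HA; apply/setP => g; rewrite [RHS]inE; apply/precolouringsP.
exists [ffun x => x \in A]; last by move=> x; rewrite inE.
by apply/colouringsP => x y /HA; rewrite !ffunE.
Qed.

(** A colouring that agrees with [g] on [S] agrees at [u] with [g] or with its flip at [u]. *)
Lemma leq_precolouringsU1 S u :
  #|precolourings S| <= #|precolourings (u |: S)| * 2.
Proof.
pose flip (g : {ffun U -> bool}) := [ffun x => (x == u) (+) g x].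
apply: (@leq_trans #|precolourings (u |: S) :|: flip @: precolourings (u |: S)|).
  apply/subset_leq_card/subsetP => g /precolouringsP[h hc e]; rewrite inE.
  case: (eqVneq (h u) (g u)) => hgu.
    apply/orP; left; apply/precolouringsP; exists h => // x /setU1P[->//|]; exact: e.
  apply/orP; right; apply/imsetP; exists (flip g); last first.
    by apply/ffunP => x; rewrite !ffunE addKb.
  apply/precolouringsP; exists h => // x; rewrite ffunE.
  case: (eqVneq x u) => [-> _|nxu /setU1P[xu|xS]].
  - by move: hgu; case: (h u); case: (g u).
  - by rewrite xu eqxx in nxu.
  - by rewrite e.
apply: leq_trans (leq_card_setU _ _) _.
by rewrite muln2 -addnn leq_add2l leq_imset_card.
Qed.

(** No edge leaves [S], so exchanging the colours outside [S] keeps a colouring proper and can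
    correct its value at [u]. *)
Lemma precolourings_closedU1 S u : u \notin S ->
  {in S, forall y z, adj H y z -> z \in S} ->
  #|precolourings S| <= #|precolourings (u |: S)|.
Proof.
move=> uS clS; apply/subset_leq_card/subsetP => g /precolouringsP[h hc e].
case: (eqVneq (h u) (g u)) => hgu; apply/precolouringsP.
  by exists h => // x /setU1P[->//|]; exact: e.
exists [ffun x => (x \notin S) (+) h x]; last first.
  move=> x /setU1P[->|xS]; rewrite ffunE ?uS ?xS; last by rewrite e.
  by move: hgu; case: (h u); case: (g u).
apply/colouringsP => x y axy; rewrite !ffunE.
have -> : (x \in S) = (y \in S).
  by apply/idP/idP => [xS|yS]; [apply: clS xS _ axy|apply: (clS y); rewrite // adjC].
move/colouringsP: hc => /(_ x y axy).
by case: (y \in S); case: (h x); case: (h y).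
Qed.

End Colourings.

(* [e] counts the vertices that are attached to an earlier one when the vertices
   of [H] are listed component by component. *)
Lemma homs_upper_bound (U V : finType) (H : sgraph U) (G : sgraph V) d :
  bipartite H -> (forall x, degree G x <= d) ->
  exists2 e, e <= #|U| & 2 ^ #|U| <= #|colourings H| * 2 ^ e /\
    #|homs H G| * #|V| ^ e <= d ^ e * #|V| ^ #|U|.
Proof.
move=> bipH degG.
suff grow j : j <= #|U| -> exists (S : {set U}) e, [/\ #|S| = j, e <= j,
    2 ^ #|U| <= #|precolourings H S| * 2 ^ e &
    #|partial_homs H G S| * #|V| ^ e <= d ^ e * #|V| ^ #|U|].
  have [S [e [cS le_e c1 c2]]] := grow _ (leqnn _).
  have eST : S = setT by apply/eqP; rewrite eqEcard subsetT cardsT cS leqnn.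
  exists e; rewrite // -precolouringsT -partial_homsT.
  by rewrite eST in c1 c2.
elim: j => [_|j IHj lt_jU].
  exists set0, 0; rewrite cards0 !muln1 mul1n partial_homs_small ?cards0 //.
  by rewrite precolourings0 // cardsT card_ffun card_bool.
have [S [e [cS le_e c1 c2]]] := IHj (ltnW lt_jU).
(* A vertex attached to [S] at most halves the number of precolourings and multiplies the bound on
   homomorphisms by [d / #|V|]. *)
case: (boolP [exists u, [exists y, [&& u \notin S, y \in S & adj H u y]]]).
  case/existsP=> u /existsP[y /and3P[uS yS uy]].
  exists (u |: S), e.+1; split; rewrite ?cardsU1 ?uS ?cS //.
    apply: leq_trans c1 _; rewrite expnS mulnA leq_mul2r.
    by rewrite leq_precolouringsU1 orbT.
  have step := leq_card_partial_homsU1 uS yS uy degG.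
  rewrite !expnS mulnA [_ * #|V|]mulnC.
  apply: leq_trans (leq_mul step (leqnn _)) _.
  by rewrite -!mulnA leq_mul2l c2 orbT.
(* Here [S] is a union of components; the next vertex starts a new one and [e] does not grow. *)
move=> /existsPn noadj.
have [u uS] : exists u, u \notin S.
  apply/existsP; rewrite -negb_forall; apply/negP => /forallP allS.
  move: lt_jU; rewrite -cS ltnNge => /negP; apply.
  by rewrite -cardsT; apply/subset_leq_card/subsetP => x _; apply: allS.
exists (u |: S), e; split; rewrite ?cardsU1 ?uS ?cS ?leqW //.
  apply: leq_trans c1 _; rewrite leq_mul2r precolourings_closedU1 ?orbT //.
  move=> y yS z yz; apply/negPn/negP => zS.
  by move: (noadj z) => /existsPn/(_ y); rewrite zS yS adjC yz.
by apply: leq_trans c2; rewrite leq_mul2r partial_homsU1_sub orbT.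
Qed.

(** The vertices are listed so that [S] stays connected. By acyclicity each new vertex has exactly
    one neighbour in [S], hence exactly [d] possible images. *)
Lemma tree_homs (U V : finType) (H : sgraph U) (G : sgraph V) d :
  tree H -> (forall x, degree G x = d) ->
  #|homs H G| * #|V| ^ #|U|.-1 = d ^ #|U|.-1 * #|V| ^ #|U|.
Proof.
case=> -[U_gt0 connH] acH degG.
pose r (S : {set U}) : rel U := fun x y => [&& adj H x y, x \in S & y \in S].
suff grow j : j < #|U| -> exists S : {set U}, [/\ #|S| = j.+1,
    {in S &, forall x y, connect (r S) x y} &
    #|partial_homs H G S| * #|V| ^ j = d ^ j * #|V| ^ #|U|].
  have [S []] := grow #|U|.-1 (ltac:(by rewrite prednK)); rewrite prednK // => cS _.
  have -> : S = setT by apply/eqP; rewrite eqEcard subsetT cardsT cS leqnn.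
  by rewrite partial_homsT.
elim: j => [_|j IHj lt_jU].
  case/card_gt0P: U_gt0 => u _.
  exists [set u]; rewrite cards1 muln1 mul1n partial_homs_small ?cards1 //.
  by split=> // x y /set1P-> /set1P->; apply: connect0.
have [S [cS connS homS]] := IHj (ltnW lt_jU).
have [u [y [uS yS uy]]] : exists u y, [/\ u \notin S, y \in S & adj H u y].
  case: (boolP [exists u, [exists y, [&& u \notin S, y \in S & adj H u y]]]).
    by case/existsP=> u /existsP[y /and3P[uS yS uy]]; exists u, y.
  (* Otherwise [S] is a nonempty union of components of a connected graph, hence everything. *)
  move=> /existsPn noadj; exfalso.
  have clS : closed (adj H) (mem S).
    move=> x z xz; apply/idP/idP => [xS|zS]; apply/negPn/negP.
      by move=> zS; move: (noadj z) => /existsPn/(_ x); rewrite zS xS adjC xz.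
    by move=> xS; move: (noadj x) => /existsPn/(_ z); rewrite zS xS xz.
  have /card_gt0P[x xS] : 0 < #|S| by rewrite cS.
  move: lt_jU; rewrite -cS ltnNge => /negP; apply.
  rewrite -cardsT; apply/subset_leq_card/subsetP => z _.
  by rewrite -(closed_connect clS (connH x z)).
have uniq_y : {in S, forall z, adj H u z -> z = y}.
  (* A simple path from [y] to a second neighbour [z], running inside [S] and so avoiding [u], would
     close a cycle through [u]. *)
  move=> z zS uz; apply/eqP/negPn/negP => nzy.
  have /connectP[p0 pth0 last0] := connS _ _ yS zS.
  case/shortenP: pth0 last0 => p pth up _ zlast.
  apply: (acH [:: u, y & p]).
    by case: p pth up zlast => //= _ _ zy; rewrite zy eqxx in nzy.
  have pS : all (mem S) p.
    elim: p (y) pth {up zlast} => //= a p IHp b /andP[/and3P[_ _ ->]].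
    exact: IHp.
  rewrite /ucycle /= -[(y \notin p) && _]/(uniq (y :: p)) up andbT.
  rewrite rcons_path -zlast uy [adj H z u]adjC uz andbT /= inE negb_or.
  apply/and3P; split.
  - by apply: sub_path pth => a b /and3P[].
  - by apply: contraNneq uS => ->.
  - by apply: contra uS => /(allP pS).
exists (u |: S); split; first by rewrite cardsU1 uS cS.
  have sub a b : r S a b -> r (u |: S) a b.
    by rewrite /r !inE => /and3P[-> -> ->]; rewrite !orbT.
  have inS a b : a \in S -> b \in S -> connect (r (u |: S)) a b.
    move=> aS bS; apply: connect_sub (connS _ _ aS bS) => a' b' /sub; exact: connect1.
  have uy' : connect (r (u |: S)) u y.
    by apply: connect1; rewrite /r uy !inE eqxx yS orbT.
  have yu' : connect (r (u |: S)) y u.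
    by apply: connect1; rewrite /r adjC uy !inE eqxx yS orbT.
  move=> a b /setU1P[->|aS] /setU1P[->|bS].
  - exact: connect0.
  - exact: connect_trans uy' (inS _ _ yS bS).
  - exact: connect_trans (inS _ _ aS yS) yu'.
  - exact: inS.
have step := eq_card_partial_homsU1 uS yS uy uniq_y degG.
by rewrite !expnS mulnA [_ * #|V|]mulnC step -!mulnA homS.
Qed.

(** * Dense regular triangle-free graphs *)

(** The edges between [A] and its complement are counted from both sides. *)
Lemma bipartite_regular_half (V : finType) (G : sgraph V) d (A : {set V}) :
  0 < d -> (forall x, degree G x = d) ->
  (forall x y, adj G x y -> (x \in A) != (y \in A)) -> #|A| = #|~: A|.
Proof.
move=> d_gt0 degG bipA; apply/eqP; rewrite -(eqn_pmul2r d_gt0) -!sum_nat_const.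
have degE x (B : {set V}) : (forall y, adj G x y -> y \in B) ->
    d = \sum_(y in B) adj G x y.
  move=> NB; rewrite -(degG x) /degree -sum1_card.
  rewrite !(big_mkcond (fun y => y \in _)); apply: eq_bigr => y _.
  by rewrite inE; case: (boolP (adj G x y)) => [/NB->|_]; last case: ifP.
apply/eqP; transitivity (\sum_(x in A) \sum_(y in ~: A) adj G x y).
  apply: eq_bigr => x xA; apply: degE => y /bipA.
  by rewrite xA inE; case: (y \in A).
rewrite exchange_big; apply: eq_bigr => y; rewrite inE => /negPf yA.
under eq_bigr do rewrite adjC; rewrite -degE // => x /bipA.
by rewrite yA; case: (x \in A).
Qed.

(** Fix an edge [x y]. Every vertex has a walk of length 2 to [x] or to [y]; those reaching [x] form
    one side. An edge inside a side would close a walk of length 5. *)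
Lemma bipartite_of_no_closed_walk5 (V : finType) (G : sgraph V) d :
  triangle_free G -> (forall x, degree G x = d) -> #|V| < 3 * d ->
  (forall a b c e f, adj G a b -> adj G b c -> adj G c e -> adj G e f ->
     ~~ adj G f a) ->
  bipartite G.
Proof.
move=> tf degG lt_n no5.
have [/card0_eq V0|/card_gt0P[x _]] := posnP #|V|.
  by exists set0 => x; have := V0 x; rewrite inE.
have /card_gt0P[y] : 0 < degree G x by rewrite degG; lia.
rewrite inE => xy.
(* The neighbourhoods of [x] and [y] are disjoint; a third one disjoint from both would require
   [3 * d] vertices. *)
have nbr z : exists2 w, adj G z w & adj G w x || adj G w y.
  apply/exists_inP; apply: contraT; rewrite negb_exists_in => /forall_inP no.
  pose N a := [set b | adj G a b].
  have dxy : [disjoint N x & N y].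
    apply/pred0P => w /=; rewrite !inE; apply/negP => /andP[xw yw].
    by have := tf _ _ _ xy yw; rewrite xw.
  have dz : [disjoint N z & N x :|: N y].
    apply/pred0P => w /=; rewrite !inE; apply/negP => /andP[/no].
    by rewrite ![adj G w _]adjC => /negPf->.
  have := max_card (N z :|: (N x :|: N y)).
  have := degG x; have := degG y; have := degG z; rewrite /degree -!/(N _).
  rewrite !cardsU (disjoint_setI0 dz) (disjoint_setI0 dxy) !cards0; lia.
exists [set z | [exists w, adj G z w && adj G w x]] => a b ab; rewrite !inE.
apply/eqP => eAB.
case: (boolP [exists w, adj G a w && adj G w x]) eAB => [/existsP[w /andP[aw wx]]|].
  move=> /esym/existsP[w' /andP[bw' w'x]].
  have := no5 _ _ _ _ _ aw wx (etrans (adjC _ _ _) w'x) (etrans (adjC _ _ _) bw').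
  by rewrite adjC ab.
move=> /existsPn naw /esym/negbT/existsPn nbw.
have [w aw wy] := nbr a; have [w' bw' w'y] := nbr b.
move: (naw w) (nbw w') wy w'y; rewrite aw bw' /= => /negPf-> /negPf-> /= wy w'y.
have := no5 _ _ _ _ _ aw wy (etrans (adjC _ _ _) w'y) (etrans (adjC _ _ _) bw').
by rewrite adjC ab.
Qed.

(** * The cycle C5 *)

Local Notation C5 := (cycle_graph 5).
Local Notation o0 := (@Ordinal 5 0 isT).
Local Notation o1 := (@Ordinal 5 1 isT).
Local Notation o2 := (@Ordinal 5 2 isT).
Local Notation o3 := (@Ordinal 5 3 isT).
Local Notation o4 := (@Ordinal 5 4 isT).

Lemma C5E (i j : 'I_5) :
  adj C5 i j = (i.+1 %% 5 == j) || (j.+1 %% 5 == i).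
Proof.
rewrite adj_graph_of_rel -!val_eqE /=.
by case: i j => [[|[|[|[|[|//]]]]] ?] [[|[|[|[|[|//]]]]] ?].
Qed.

Lemma ord5P (P : 'I_5 -> Prop) :
  P o0 -> P o1 -> P o2 -> P o3 -> P o4 -> forall i, P i.
Proof.
by move=> ? ? ? ? ? [[|[|[|[|[|//]]]]] lt_i]; rewrite (bool_irrelevance lt_i isT).
Qed.

Lemma sum_ord5 (F : 'I_5 -> nat) :
  \sum_i F i = F o0 + F o1 + F o2 + F o3 + F o4.
Proof.
rewrite !big_ord_recl big_ord0 addn0 !addnA.
by congr (F _ + F _ + F _ + F _ + F _); apply: val_inj.
Qed.

Ltac C5_witness tac :=
  solve [exists o0; tac | exists o1; tac | exists o2; tac | exists o3; tac
       | exists o4; tac].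

(** [C5] has diameter 2, and [i = j] is allowed. In [adj_classes] the common neighbour [l] produces
    a triangle through [v l]. *)
Lemma C5_common_neighbour (i j : 'I_5) :
  ~~ adj C5 i j -> exists2 l, adj C5 i l & adj C5 j l.
Proof.
move: i j; refine (ord5P _ _ _ _ _); refine (ord5P _ _ _ _ _); rewrite C5E // => _;
  C5_witness ltac:(by rewrite C5E).
Qed.

Lemma C5_other_neighbour (i j : 'I_5) : adj C5 i j ->
  exists l, [/\ adj C5 i l, j != l & forall m, adj C5 i m -> m = j \/ m = l].
Proof.
move: i j; refine (ord5P _ _ _ _ _); refine (ord5P _ _ _ _ _); rewrite C5E // => _;
  C5_witness ltac:(split; [by rewrite C5E | by [] |
    by refine (ord5P _ _ _ _ _); rewrite C5E // => _; (by left) || (by right)]).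
Qed.

Lemma C5_neighbours_inj (i j : 'I_5) :
  (forall l, adj C5 j l -> adj C5 i l) -> i = j.
Proof.
move: i j; refine (ord5P _ _ _ _ _); refine (ord5P _ _ _ _ _); move=> // h; exfalso;
  move: (h o0) (h o1) (h o2) (h o3) (h o4); rewrite !C5E;
  move=> h0 h1 h2 h3 h4;
  solve [by have := h0 isT | by have := h1 isT | by have := h2 isT |
         by have := h3 isT | by have := h4 isT].
Qed.

(** An independent set of [C5] has at most two elements, and nonadjacent vertices have a common
    neighbour. This will choose the class of a vertex from the parts that its neighbourhood
    meets. *)
Lemma C5_independent (P : pred 'I_5) :
  (forall i j, P i -> P j -> ~~ adj C5 i j) ->
  exists i, forall j, P j -> adj C5 i j.
Proof.
move=> indP.
have excl i j : adj C5 i j -> P i -> P j -> False.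
  by move=> ij Pi Pj; move: (indP i j Pi Pj); rewrite ij.
suff [i iP] : exists i : 'I_5, forall j : 'I_5, P j ==> adj C5 i j.
  by exists i => j; apply/implyP.
have := excl o0 o1; have := excl o1 o2; have := excl o2 o3.
have := excl o3 o4; have := excl o4 o0; rewrite !C5E.
case P0: (P o0); case P1: (P o1); case P2: (P o2); case P3: (P o3);
  case P4: (P o4) => h40 h34 h23 h12 h01;
  first [ by case: h40 | by case: h34 | by case: h23 | by case: h12
        | by case: h01
        | C5_witness ltac:(by refine (ord5P _ _ _ _ _);
            rewrite ?P0 ?P1 ?P2 ?P3 ?P4 // C5E) ].
Qed.

(** * Classes of vertices around a closed 5-walk *)

Section AroundC5.
Variables (V : finType) (G : sgraph V) (d : nat) (v : 'I_5 -> V).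
Hypotheses (tfG : triangle_free G) (degG : forall x, degree G x = d).
Hypothesis vC5 : forall i j, adj C5 i j -> adj G (v i) (v j).

Let N x : {set V} := [set y | adj G x y].
(* The part of the blow-up that replaces the vertex [i]. *)
Let A i : {set V} := [set x | [forall j, adj C5 i j ==> adj G x (v j)]].
Let R : {set V} := [set x | \sum_i (x \in A i) == 0].

Let AP i x : reflect (forall j, adj C5 i j -> adj G x (v j)) (x \in A i).
Proof.
rewrite inE; apply: (iffP forallP) => h j; first exact/implyP/h.
exact/implyP/h.
Qed.

Let AE i j l x : adj C5 i j -> adj C5 i l -> j != l ->
  (x \in A i) = adj G x (v j) && adj G x (v l).
Proof.
move=> ij il njl; apply/AP/andP => [h|[xj xl] m im]; first by split; apply: h.
have [l' [_ _ e]] := C5_other_neighbour ij.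
have el : l = l' by case: (e l il) njl => [->|//]; rewrite eqxx.
by case: (e m im) => -> //; rewrite -el.
Qed.

(** By triangle-freeness the neighbours of [x] on the walk have independent indices. Two such
    indices are the neighbourhood of a unique [i], and [x] lies in [A i] only; with at most one, [x]
    lies in [R]. *)
Let class_count x : \sum_i (x \in A i) + (x \in R) = 1 /\
  \sum_i adj G x (v i) + (x \in R) <= 2.
Proof.
have excl i j : adj C5 i j -> ~~ (adj G x (v i) && adj G x (v j)).
  move=> ij; apply/negP => /andP[xi xj].
  by have := tfG xi (vC5 ij); rewrite xj.
rewrite [x \in R]inE !sum_ord5 (@AE o0 o1 o4) ?(@AE o1 o0 o2) ?(@AE o2 o1 o3)
  ?(@AE o3 o2 o4) ?(@AE o4 o0 o3) ?C5E //.
move: (@excl o0 o1) (@excl o1 o2) (@excl o2 o3) (@excl o3 o4) (@excl o4 o0).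
rewrite !C5E => /(_ isT) + /(_ isT) + /(_ isT) + /(_ isT) + /(_ isT).
case: (adj G x (v o0)); case: (adj G x (v o1)); case: (adj G x (v o2));
  by case: (adj G x (v o3)); case: (adj G x (v o4)).
Qed.

Let decomp (X : {set V}) : #|X| = \sum_i #|X :&: A i| + #|X :&: R|.
Proof.
have cardI (B : {set V}) : #|X :&: B| = \sum_(x in X) (x \in B).
  rewrite -sum1_card big_mkcond [RHS]big_mkcond; apply: eq_bigr => x _.
  by rewrite inE; case: (x \in X); case: (x \in B).
rewrite cardI; under [in RHS]eq_bigr do rewrite cardI.
rewrite exchange_big -big_split -sum1_card; apply: eq_bigr => x _ /=.
by have [-> _] := class_count x.
Qed.

(** [class_count] is summed over [x], counting the edges to the walk from both ends. Keeping the
    term [#|R|] shows that [R] is small when [d] is close to [2 * #|V| / 5]. *)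
Let C5_degree_sum : 5 * d + #|R| <= 2 * #|V|.
Proof.
have cardS (P : pred V) : #|[set x | P x]| = \sum_x P x.
  by rewrite -sum1_card big_mkcond; apply: eq_bigr => x _; rewrite inE; case: (P x).
have -> : 5 * d = \sum_(i < 5) \sum_x adj G x (v i).
  rewrite -{1}(card_ord 5) -sum_nat_const; apply: eq_bigr => i _.
  by rewrite -(degG (v i)) /degree cardS; apply: eq_bigr => x _; rewrite adjC.
have -> : #|R| = \sum_x (x \in R).
  by rewrite -cardS; apply: eq_card => x; rewrite [RHS]inE.
rewrite exchange_big -big_split mulnC -sum_nat_const; apply: leq_sum => x _ /=.
by have [] := class_count x.
Qed.

Lemma C5_degree : 5 * d <= 2 * #|V|.
Proof. exact: leq_trans (leq_addr _ _) C5_degree_sum. Qed.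

Let adj_classes i j x y : x \in A i -> adj G x y -> y \in A j -> adj C5 i j.
Proof.
move=> /AP xi xy /AP yj; apply: contraT => /C5_common_neighbour[l il jl].
have := tfG xy (yj _ jl); by rewrite xi.
Qed.

Let degree_split i j l x : adj C5 i j -> adj C5 i l -> j != l ->
  (forall m y, adj G x y -> y \in A m -> adj C5 i m) ->
  d <= #|N x :&: A j| + #|N x :&: A l| + #|R|.
Proof.
move=> ij il njl Nx; rewrite -(degG x) /degree -/(N x) (decomp (N x)).
apply: leq_add; last exact/subset_leq_card/subsetIr.
rewrite (bigD1 j) // (bigD1 l) /=; last by rewrite eq_sym.
rewrite big1 ?addn0 // => m /andP[nmj nml]; apply/eqP.
rewrite cards_eq0 -subset0; apply/subsetP => y; rewrite inE => /andP[].
rewrite inE => xy /(Nx _ _ xy) im; have [l' [_ _ e]] := C5_other_neighbour ij.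
have el : l = l' by case: (e l il) njl => [->|//]; rewrite eqxx.
by case: (e m im) nmj nml => [->|->]; rewrite -?el ?eqxx.
Qed.

Let nbr_v i m y : adj G (v i) y -> y \in A m -> adj C5 i m.
Proof.
move=> iy /AP ym; apply: contraT => /C5_common_neighbour[l il ml].
by have := tfG iy (ym _ ml); rewrite vC5.
Qed.

Let pair_le i j l : adj C5 i j -> adj C5 i l -> j != l -> #|A j| + #|A l| <= d.
Proof.
move=> ij il njl; rewrite -(degG (v i)) /degree -/(N _) (decomp (N _)).
have sub m : adj C5 i m -> A m \subset N (v i).
  by move=> im; apply/subsetP => x /AP xm; rewrite inE adjC xm // adjC.
apply: leq_trans (leq_addr _ _).
rewrite (bigD1 j) // (bigD1 l) /=; last by rewrite eq_sym.
by rewrite addnA; apply: leq_trans (leq_addr _ _); rewrite !(setIidPr _) ?sub.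
Qed.

Let pair_ge i j l : adj C5 i j -> adj C5 i l -> j != l ->
  d <= #|A j| + #|A l| + #|R|.
Proof.
move=> ij il njl; apply: leq_trans (degree_split ij il njl (@nbr_v i)) _.
by rewrite leq_add2r leq_add // subset_leq_card // subsetIr.
Qed.

(** The four parts other than [A i] form two pairs, each with a common neighbour in [C5]; by
    [pair_le] and [pair_ge] each pair has order [d] up to [#|R|]. *)
Let class_size i : #|A i| <= #|V| + #|R| - 2 * d /\ #|V| <= #|A i| + #|R| + 2 * d.
Proof.
have le i' j l : _ := @pair_le i' j l; have ge i' j l : _ := @pair_ge i' j l.
have := decomp setT; rewrite cardsT setTI sum_ord5 !setTI.
move: (@le o0 o1 o4) (@le o1 o0 o2) (@le o2 o1 o3) (@le o3 o2 o4) (@le o4 o0 o3).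
move: (@ge o0 o1 o4) (@ge o1 o0 o2) (@ge o2 o1 o3) (@ge o3 o2 o4) (@ge o4 o0 o3).
rewrite !C5E; do 10 move=> /(_ isT isT isT) ?.
by move: i; refine (ord5P _ _ _ _ _); lia.
Qed.

Let disjoint_neighbours (B : {set V}) x y : adj G x y ->
  #|N x :&: B| + #|N y :&: B| <= #|B|.
Proof.
move=> xy; have dxy : [disjoint N x :&: B & N y :&: B].
  apply/pred0P => z /=; rewrite !inE.
  apply/negP => /andP[/andP[xz _] /andP[yz _]].
  by have := tfG xy yz; rewrite xz.
have := cardsUI (N x :&: B) (N y :&: B).
rewrite (disjoint_setI0 dxy) cards0 addn0 => <-.
by rewrite subset_leq_card // subUset !subsetIr.
Qed.

(** By [degree_split] and [pair_le], [y] is adjacent to all but at most [#|R|] vertices of [A j],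
    and [x] has no common neighbour with [y]. *)
Let touched_small i j x y : adj G x y -> y \in A i -> adj C5 i j ->
  #|N x :&: A j| <= #|R|.
Proof.
move=> xy yi ij; have [l [il njl _]] := C5_other_neighbour ij.
have := degree_split ij il njl (fun m z yz zm => adj_classes yi yz zm).
have := pair_le ij il njl.
have : #|N y :&: A l| <= #|A l| by rewrite subset_leq_card // subsetIr.
by have := disjoint_neighbours (A j) xy; lia.
Qed.

(** With [C5_degree_sum], the bound [d >= 0.396 * #|V|] gives [#|R| <= #|V| / 50]. *)
Hypothesis (V_gt0 : 0 < #|V|) (d_large : 99 * #|V| <= 250 * d).

(* A neighbourhood meeting two consecutive parts has at most [#|R|] vertices in
   four of the five parts, which is too few. *)
Let touched_independent i j x y z : adj G x y -> y \in A i ->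
  adj G x z -> z \in A j -> ~~ adj C5 i j.
Proof.
move=> xy yi xz zj; apply/negP => ij.
(* Summed over the parts and [R], this gives [3 * d <= #|V| + 6 * #|R|], against [d_large]. *)
have le m : #|N x :&: A m| <=
    if adj C5 i m || adj C5 j m then #|R| else #|V| + #|R| - 2 * d.
  case: ifP => [/orP[]|_]; [exact: touched_small xy yi|exact: touched_small xz zj|].
  have [+ _] := class_size m; apply: leq_trans.
  by rewrite subset_leq_card // subsetIr.
have := decomp (N x); rewrite sum_ord5 -/(degree G x) degG.
have : #|N x :&: R| <= #|R| by rewrite subset_leq_card // subsetIr.
move: (le o0) (le o1) (le o2) (le o3) (le o4) C5_degree_sum ij V_gt0 d_large.
move: {yi zj le} (#|N x :&: R|) (#|N x :&: A o0|) (#|N x :&: A o1|)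
  (#|N x :&: A o2|) (#|N x :&: A o3|) (#|N x :&: A o4|) (#|R|) (#|V|).
move: i j; refine (ord5P _ _ _ _ _); refine (ord5P _ _ _ _ _);
  rewrite !C5E //=; clear; lia.
Qed.

Lemma C5_homomorphism : exists p : V -> 'I_5,
  (forall u, exists x, p x = u) /\
  forall x y, adj G x y -> adj C5 (p x) (p y).
Proof.
have /fin_all_exists[p pP] x : exists i, forall m y,
    adj G x y -> y \in A m -> adj C5 i m.
  (* The parts met by [N x] have independent indices by [touched_independent]. *)
  have [i iP] := @C5_independent (fun i => [exists y in A i, adj G x y])
    (fun i j hi hj => let: ex_intro2 y yi xy := exists_inP hi in
       let: ex_intro2 z zj xz := exists_inP hj in touched_independent xy yi xz zj).
  by exists i => m y xy ym; apply: iP; apply/exists_inP; exists y.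
(* [N x] meets only two parts besides [R], so it fills more than half of each. *)
have big x j : adj C5 (p x) j -> 3 * d <= #|N x :&: A j| + #|V| + 2 * #|R|.
  move=> ij; have [l [il njl _]] := C5_other_neighbour ij.
  have := degree_split ij il njl (pP x); have [+ _] := class_size l.
  have : #|N x :&: A l| <= #|A l| by rewrite subset_leq_card // subsetIr.
  by have := C5_degree_sum; lia.
exists p; split=> [i|x y xy].
  have /card_gt0P[x xi] : 0 < #|A i|.
    by have [_] := class_size i; have := C5_degree_sum; lia.
  (* Each neighbour [l] of [p x] is a neighbour of [i], since [x] has a neighbour in [A l]; in [C5]
     this inclusion of neighbourhoods forces [p x = i]. *)
  exists x; symmetry; apply: C5_neighbours_inj => l xl.
  have /card_gt0P[y] : 0 < #|N x :&: A l|.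
    by have := big _ _ xl; have := C5_degree_sum; lia.
  by rewrite inE => /andP[]; rewrite inE; apply: adj_classes xi.
(* Otherwise [x] and [y] would each be adjacent to more than half of the same [A l], although
   adjacent vertices have no common neighbour. *)
apply: contraT => /C5_common_neighbour[l xl yl].
have := big _ _ xl; have := big _ _ yl; have [+ _] := class_size l.
by have := disjoint_neighbours (A l) xy; have := C5_degree_sum; lia.
Qed.

End AroundC5.

Lemma bipartite_or_C5 (V : finType) (G : sgraph V) d :
  triangle_free G -> (forall x, degree G x = d) -> #|V| < 3 * d ->
  bipartite G \/
  exists v : 'I_5 -> V, forall i j, adj C5 i j -> adj G (v i) (v j).
Proof.
move=> tfG degG lt_n.
case: (boolP [exists a, exists b, exists c, exists e, exists f,
  [&& adj G a b, adj G b c, adj G c e, adj G e f & adj G f a]]).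
  case/existsP=> a /existsP[b /existsP[c /existsP[e /existsP[f]]]].
  case/and5P=> ab bc ce ef fa; right.
  exists (fun i => nth a [:: a; b; c; e; f] i).
  by refine (ord5P _ _ _ _ _); refine (ord5P _ _ _ _ _);
    rewrite C5E //= => _; rewrite // adjC.
move=> /existsPn no; left.
apply: (bipartite_of_no_closed_walk5 tfG degG lt_n).
move=> a b c e f ab bc ce ef; apply: contra (no a) => fa.
apply/existsP; exists b; apply/existsP; exists c; apply/existsP; exists e.
by apply/existsP; exists f; apply/and5P.
Qed.

(** * Comparison with T(n,2) *)

Lemma embeddings_edgeless (U V : finType) (H : sgraph U) (G : sgraph V) :
  (forall x y, ~~ adj H x y) ->
  embeddings H G = [set f : {ffun U -> V} | injectiveb f].
Proof.
move=> noH; apply/setP => f; rewrite !inE [X in X && _](_ : _ = true) //.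
by apply/forallP => x; apply/forallP => y; rewrite (negPf (noH x y)).
Qed.

Lemma leq_embeddings (U V W : finType) (H : sgraph U) (G : sgraph V)
    (G' : sgraph W) (g : V -> W) :
  injective g -> (forall x y, adj G x y -> adj G' (g x) (g y)) ->
  #|embeddings H G| <= #|embeddings H G'|.
Proof.
move=> injg homg; pose F (f : {ffun U -> V}) := [ffun x => g (f x)].
have injF : injective F.
  by move=> f f' /ffunP e; apply/ffunP => x; move: (e x); rewrite !ffunE => /injg.
rewrite -(card_imset _ injF); apply/subset_leq_card/subsetP => _ /imsetP[f + ->].
rewrite [f \in _]inE [_ \in embeddings _ _]inE => /andP[/homsP fh /injectiveP injf].
apply/andP; split; first by apply/homsP => x y /fh; rewrite !ffunE; apply: homg.
by apply/injectiveP => x y; rewrite !ffunE => /injg/injf.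
Qed.

(** The [k]-th element of [A] goes to the [k]-th element of [B], and likewise for the
    complements. *)
Lemma ex_injection_preserving (V W : finType) (A : {set V}) (B : {set W}) :
  #|A| <= #|B| -> #|~: A| <= #|~: B| ->
  exists2 g : V -> W, injective g & forall x, (g x \in B) = (x \in A).
Proof.
move=> leAB leAB'.
have [V0|/card_gt0P[x0 _]] := posnP #|V|.
  have V0' (x : V) : False by have := card0_eq V0 x; rewrite inE.
  by exists (fun x => False_rect W (V0' x)) => x; case: (V0' x).
(* [y0] serves only as the default value of [nth]. *)
have [y0 _] : exists y0 : W, true.
  have : 0 < #|A| + #|~: A| by rewrite cardsC; apply/card_gt0P; exists x0.
  case: (posnP #|A|) => [->|A0 _]; first rewrite add0n => A0.
    by have /card_gt0P[y _] := leq_trans A0 leAB'; exists y.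
  by have /card_gt0P[y _] := leq_trans A0 leAB; exists y.
pose h (X : {set V}) (Y : {set W}) x := nth y0 (enum Y) (index x (enum X)).
have hP (X : {set V}) (Y : {set W}) x : #|X| <= #|Y| -> x \in X -> h X Y x \in Y.
  move=> leXY xX; rewrite -mem_enum mem_nth // -cardE (leq_trans _ leXY) //.
  by rewrite cardE index_mem mem_enum.
have h_inj (X : {set V}) (Y : {set W}) : #|X| <= #|Y| -> {in X &, injective (h X Y)}.
  move=> leXY x y xX yX /eqP; rewrite nth_uniq ?enum_uniq //.
  - by move/eqP/index_inj; move=> ->; rewrite ?mem_enum.
  - by rewrite -cardE (leq_trans _ leXY) // cardE index_mem mem_enum.
  - by rewrite -cardE (leq_trans _ leXY) // cardE index_mem mem_enum.
pose g x := if x \in A then h A B x else h (~: A) (~: B) x.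
have gE x : (g x \in B) = (x \in A).
  rewrite /g; case: ifP => xA; first exact: hP.
  by apply/negbTE; rewrite -in_setC; apply: hP => //; rewrite inE xA.
exists g => // x y exy; have := gE x; rewrite exy gE /g => eA.
move: exy; rewrite /g -eA; case: ifP => yA; first by apply: h_inj; rewrite // -eA.
by apply: h_inj; rewrite // inE -?eA yA.
Qed.

Lemma card_ord_lt n m : m <= n -> #|[set i : 'I_n | i < m]| = m.
Proof.
move=> le_mn; rewrite -[RHS]card_ord.
have inj : injective (widen_ord le_mn).
  by move=> i j /(congr1 val) e; apply: val_inj.
rewrite -(card_codom inj); apply: eq_card => i; rewrite inE.
apply/idP/codomP => [lt_im|[j ->]]; last exact: ltn_ord j.
by exists (Ordinal lt_im); apply: val_inj.
Qed.

Section Turan.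
Variable m : nat.
Let T := turan2 (m + m).

Lemma adj_turan2 (x y : 'I_(m + m)) : adj T x y = ((x < m) != (y < m)).
Proof.
rewrite adj_graph_of_rel (_ : (m + m)./2 = m); last by rewrite addnn doubleK.
case: (eqVneq x y) => [->|_] /=; first by rewrite eqxx.
by rewrite ![m <= _]leqNgt; case: (x < m); case: (y < m).
Qed.

Lemma turan2_triangle_free : triangle_free T.
Proof.
move=> x y z; rewrite !adj_turan2.
by case: (x < m); case: (y < m); case: (z < m).
Qed.

Lemma degree_turan2 x : degree T x = m.
Proof.
have c1 := card_ord_lt (leq_addr m m).
have := cardsC [set i : 'I_(m + m) | i < m]; rewrite c1 card_ord => /addnI c2.
case: (boolP (x < m)) => xm; [rewrite -[RHS]c2|rewrite -[RHS]c1]; apply: eq_card => y.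
  by rewrite !inE adj_turan2 xm.
by rewrite !inE adj_turan2 (negPf xm); case: (y < m).
Qed.

(** A colouring chooses the side of every vertex, and a map to ['I_m] its place on that side. *)
Lemma turan2_homs (U : finType) (H : sgraph U) :
  #|colourings H| * m ^ #|U| <= #|homs H T|.
Proof.
have -> : m ^ #|U| = #|[set: {ffun U -> 'I_m}]| by rewrite cardsT card_ffun card_ord.
rewrite -cardsX.
pose F (p : {ffun U -> bool} * {ffun U -> 'I_m}) : {ffun U -> 'I_(m + m)} :=
  [ffun x => unsplit (if p.1 x then inl (p.2 x) else inr (p.2 x))].
have F_inj : injective F.
  case=> c g [c' g'] /ffunP e.
  have {}e x : c x = c' x /\ g x = g' x.
    move: (e x); rewrite !ffunE => /(can_inj unsplitK) /=.
    by case: (c x); case: (c' x) => // -[].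
  by congr (_, _); apply/ffunP => x; case: (e x).
rewrite -(card_imset _ F_inj); apply/subset_leq_card/subsetP => _ /imsetP[[c g] + ->].
rewrite in_setX => /andP[/colouringsP cP _]; apply/homsP => x y /cP.
have F_lt z : (F (c, g) z < m) = c z.
  rewrite ffunE /=; case: (c z) => /=; first by rewrite ltn_ord.
  by rewrite ltnNge leq_addr.
by rewrite adj_turan2 !F_lt.
Qed.

End Turan.

(** With [n = m + m] and [k = #|U|], there are at most [(2/5)^e * n^k] homomorphisms to [G] and at
    least [(1/2)^e * n^k] to T(n,2). As [e > 0], the gap absorbs the noninjective maps. *)
Lemma embeddings_leq_turan2 (U : finType) (H : sgraph U) m
    (G : sgraph 'I_(m + m)) d a b :
  bipartite H -> adj H a b -> (forall x, degree G x <= d) ->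
  5 * d <= 2 * (m + m) -> 5 * 2 ^ #|U| * #|U| ^ 2 <= m + m ->
  #|embeddings H G| <= #|embeddings H (turan2 (m + m))|.
Proof.
move=> bipH ab degG d_small n_large.
have U_gt0 : 0 < #|U| by apply/card_gt0P; exists a.
have [e le_e [col homG]] := homs_upper_bound bipH degG.
have := turan2_homs m H; have := leq_homs_embeddings H (turan2 (m + m)).
have embG : #|embeddings H G| <= #|homs H G|.
  by apply/subset_leq_card/subsetP => f; rewrite inE => /andP[].
(* For [e = 0] every map would be a proper colouring, even a constant one, against the edge
   [a b]. *)
have e_gt0 : 0 < e.
  rewrite lt0n; apply/eqP => e0; move: col; rewrite e0 muln1.
  rewrite -card_bool -card_ffun -cardsT => le_col.
  have /colouringsP/(_ a b ab) : [ffun => true] \in colourings H.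
    suff -> : colourings H = setT by rewrite inE.
    by apply/eqP; rewrite eqEcard subsetT.
  by rewrite !ffunE.
move: embG homG col; rewrite card_ord.
move: (#|homs H G|) (#|homs H (turan2 (m + m))|) (#|embeddings H G|) => X Y E.
move: (#|embeddings H (turan2 (m + m))|) (#|colourings H|) => E' C.
set n := m + m in d_small n_large *; set p := n ^ #|U|.
move=> leEX homG col leYE leCY.
have n_gt0 : 0 < n.
  by apply: leq_trans n_large; rewrite !muln_gt0 !expn_gt0 U_gt0.
have p_gt0 : 0 < p by rewrite expn_gt0 n_gt0.
have s1 : 5 ^ e * X <= 2 ^ e * p.
  rewrite -(leq_pmul2r (_ : 0 < n ^ e)) ?expn_gt0 ?n_gt0 // -mulnA.
  apply: leq_trans (leq_mul (leqnn _) homG) _.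
  rewrite [X in _ <= X]mulnAC mulnA -!expnMn.
  by rewrite leq_mul2r leq_exp2r // d_small orbT.
(* As [e > 0], [(4/5)^e] is at most [4/5]. *)
have s2 : 5 * 2 ^ e * X <= 4 * p.
  case: e e_gt0 s1 {le_e homG col} => // e _ s1.
  rewrite -(leq_pmul2l (_ : 0 < 5 ^ e)) ?expn_gt0 //.
  have -> : 5 ^ e * (5 * 2 ^ e.+1 * X) = 2 ^ e.+1 * (5 ^ e.+1 * X).
    by rewrite !expnS; lia.
  apply: leq_trans (leq_mul (leqnn _) s1) _.
  have -> : 2 ^ e.+1 * (2 ^ e.+1 * p) = 4 ^ e * (4 * p).
    by rewrite mulnA -expnMn expnS -mulnA mulnCA.
  by rewrite leq_mul2r; apply/orP; right; elim: (e) => // e'; rewrite !expnS; lia.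
have s3 : n * p <= 2 ^ e * (n * E' + #|U| ^ 2 * p).
  apply: leq_trans (leq_mul (leqnn (2 ^ e)) leYE).
  have -> : p = 2 ^ #|U| * m ^ #|U| by rewrite -expnMn mul2n -addnn.
  rewrite [X in _ <= X]mulnCA leq_mul2l; apply/orP; right.
  apply: leq_trans (leq_mul col (leqnn _)) _.
  by rewrite mulnAC mulnC leq_mul2l leCY orbT.
(* The noninjective maps take at most one fifth of [p / 2 ^ e], which is the share left by [s2];
   hence the threshold on [n]. *)
have s4 : 5 * 2 ^ e * #|U| ^ 2 * p <= n * p.
  rewrite leq_mul2r (leq_trans _ n_large) ?orbT // leq_mul2r.
  by rewrite leq_mul2l leq_exp2l // le_e !orbT.
apply: leq_trans leEX _.
rewrite -(leq_pmul2l (_ : 0 < n * (5 * 2 ^ e))) ?muln_gt0 ?n_gt0 ?expn_gt0 //.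
rewrite -!mulnA in s2 s3 s4 *.
have : n * (5 * (2 ^ e * X)) <= n * (4 * p) by rewrite leq_mul2l s2 orbT.
have -> : n * (5 * (2 ^ e * E')) = 5 * (2 ^ e * (n * E')) by lia.
rewrite mulnDr in s3; lia.
Qed.

(** * The extremal graphs *)

(** A closed 5-walk would give [5 * d <= 2 * #|V|] by [C5_degree]. *)
Lemma regular_bipartite (V : finType) (G : sgraph V) d :
  triangle_free G -> (forall x, degree G x = d) -> 2 * #|V| < 5 * d ->
  bipartite G.
Proof.
move=> tfG degG d_large.
have [||[v vC5]] // := bipartite_or_C5 tfG degG; first by lia.
by have := C5_degree tfG degG vC5; lia.
Qed.

Lemma transport_ord (W : finType) (G : sgraph W) n : #|W| = n ->
  exists2 G' : sgraph 'I_n, (forall d, (forall x, degree G x = d) ->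
    forall x, degree G' x = d) & (triangle_free G -> triangle_free G').
Proof.
move=> <-; exists (graph_of_rel (fun i j : 'I_#|W| => adj G (enum_val i) (enum_val j))).
  move=> d degG i; rewrite -(degG (enum_val i)) /degree.
  rewrite -(card_imset _ enum_val_inj); apply: eq_card => w.
  rewrite inE; apply/imsetP/idP => [[j + ->]|iw].
    by rewrite inE adj_graph_of_rel [adj G (enum_val j) _]adjC orbb => /andP[].
  exists (enum_rank w); last by rewrite enum_rankK.
  rewrite inE adj_graph_of_rel enum_rankK iw andbT.
  by apply: contraTneq iw => ->; rewrite enum_rankK adjxx.
move=> tfG i j k; rewrite !adj_graph_of_rel.
rewrite ![adj G (enum_val j) (enum_val i)]adjC ![adj G (enum_val k) _]adjC !orbb.
by move=> /andP[_ ij] /andP[_ jk]; rewrite (negPf (tfG _ _ _ ij jk)) andbF.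
Qed.

(** Adding [i] permutes the residues modulo [b]. Hence [(i + j) %% b < a] defines an [a]-regular
    bipartite graph between two copies of ['I_b]. *)
Lemma sum_circulant a b (i : 'I_b) : a <= b ->
  \sum_(j < b) ((i + j) %% b < a) = a.
Proof.
move=> le_ab; have b_gt0 : 0 < b by apply: leq_trans (ltn_ord i).
pose h (j : 'I_b) := Ordinal (ltn_pmod (i + j) b_gt0).
have h_inj : injective h.
  move=> j k /(congr1 val)/eqP; rewrite /= eqn_modDl !modn_small //.
  by move/eqP/val_inj.
transitivity (\sum_(j < b) (j < a)); first by rewrite [RHS](reindex_inj h_inj).
rewrite -[RHS](card_ord_lt le_ab) -sum1_card [RHS]big_mkcond.
by apply: eq_bigr => j _; rewrite inE; case: (j < a).
Qed.

(* The blow-up of C5 with parts of orders a - c, a, a + c, a + c, a, in which the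
   complete bipartite graph between the two parts of order a + c is thinned out
   to an a-regular one; this makes every degree equal to 2a. *)
Section Dense.
Variables a c : nat.
Let b := a + c.
Let W : finType := ('I_(a - c) + ('I_a + ('I_b + ('I_b + 'I_a))))%type.

Definition dense_rel (x y : W) : bool :=
  match x, y with
  | inl _, inr (inl _) | inr (inl _), inl _ => true
  | inl _, inr (inr (inr (inr _))) | inr (inr (inr (inr _))), inl _ => true
  | inr (inl _), inr (inr (inl _)) | inr (inr (inl _)), inr (inl _) => true
  | inr (inr (inr (inl _))), inr (inr (inr (inr _))) => true
  | inr (inr (inr (inr _))), inr (inr (inr (inl _))) => true
  | inr (inr (inl i)), inr (inr (inr (inl j))) => (i + j) %% b < a
  | inr (inr (inr (inl i))), inr (inr (inl j)) => (i + j) %% b < a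
  | _, _ => false
  end.

Definition dense_graph : sgraph W := graph_of_rel dense_rel.

Lemma adj_dense x y : adj dense_graph x y = dense_rel x y.
Proof.
rewrite adj_graph_of_rel.
have symr : dense_rel y x = dense_rel x y.
  by case: x y => [?|[?|[?|[?|?]]]] [?|[?|[?|[?|?]]]] //=; rewrite addnC.
rewrite symr orbb; case: (eqVneq x y) => [<-|//].
by case: x {symr} => [?|[?|[?|[?|?]]]].
Qed.

Lemma dense_triangle_free : triangle_free dense_graph.
Proof.
move=> x y z; rewrite !adj_dense.
by case: x y z => [?|[?|[?|[?|?]]]] [?|[?|[?|[?|?]]]] [?|[?|[?|[?|?]]]].
Qed.

Lemma degree_dense x : c <= a -> degree dense_graph x = 2 * a.
Proof.
move=> le_ca; have le_ab : a <= b by rewrite leq_addr.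
have -> : degree dense_graph x = \sum_y dense_rel x y.
  rewrite /degree -sum1_card big_mkcond; apply: eq_bigr => y _.
  by rewrite inE adj_dense; case: ifP.
rewrite !big_sumType /=.
case: x => [?|[?|[i|[i|?]]]] /=; rewrite ?sum_circulant // !sum_nat_const !card_ord /b; lia.
Qed.

Lemma card_dense : c <= a -> #|W| = 5 * a + c.
Proof. by move=> le_ca; rewrite !card_sum !card_ord /b; lia. Qed.

End Dense.

(** Write [n = 5 * a + c] with [c < 5]. The degree [2 * a] is at least [2 * (n - 4) / 5], which
    exceeds [0.398 * n] for these [n]. *)
Lemma ex_dense_regular n : 1000 <= n -> exists2 G : sgraph 'I_n, triangle_free G &
  exists2 d, (forall x, degree G x = d) & 199 * n <= 500 * d.
Proof.
move=> n_large; have lt_c : n %% 5 < 5 by rewrite ltn_mod.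
have nE := divn_eq n 5; have le_c : n %% 5 <= n %/ 5 by lia.
have cW : #|{: 'I_(n %/ 5 - n %% 5) + ('I_(n %/ 5) + ('I_(n %/ 5 + n %% 5) +
    ('I_(n %/ 5 + n %% 5) + 'I_(n %/ 5))))}| = n.
  by rewrite card_dense // {3}nE; lia.
have [G degG tfG] := transport_ord (dense_graph (n %/ 5) (n %% 5)) cW.
exists G; first exact/tfG/dense_triangle_free.
exists (2 * (n %/ 5)); last by lia.
by apply: degG => x; apply: degree_dense.
Qed.

(** Degrees below [0.396 * n] and at least [0.398 * n] have ratio at most [198/199], and so do the
    counts [n * d ^ (k - 1)] for [k > 1]. For large [n] this gap exceeds the number of noninjective
    maps, which is [O(n ^ (k - 1))]. *)
Lemma tree_embeddings_lt (U V W : finType) (H : sgraph U) (G : sgraph V)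
    (G' : sgraph W) d d' :
  tree H -> 1 < #|U| -> #|V| = #|W| -> (forall x, degree G x = d) ->
  (forall x, degree G' x = d') -> 250 * d < 99 * #|V| ->
  199 * #|V| <= 500 * d' -> 199 * #|U| ^ 2 * 3 ^ #|U| < #|V| ->
  #|embeddings H G| < #|embeddings H G'|.
Proof.
move=> treeH U_gt1 eqVW degG degG' d_small d'_large n_large.
have embG : #|embeddings H G| <= #|homs H G|.
  by apply/subset_leq_card/subsetP => f; rewrite inE => /andP[].
apply: leq_ltn_trans embG _.
have := tree_homs treeH degG; have := tree_homs treeH degG'.
have := leq_homs_embeddings H G'; rewrite -eqVW.
move: (#|homs H G|) (#|homs H G'|) (#|embeddings H G'|) => X Y E.
case: #|U| U_gt1 n_large => // K; rewrite ltnS /= => K_gt0.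
move: (#|V|) d_small d'_large => n d_small d'_large n_large leY.
have n_gt0 : 0 < n by apply: leq_ltn_trans n_large.
have nK_gt0 : 0 < n ^ K by rewrite expn_gt0 n_gt0.
rewrite ![n ^ K.+1]expnS !mulnA => /eqP; rewrite eqn_pmul2r // => /eqP eY.
move/eqP; rewrite eqn_pmul2r // => /eqP eX.
have leE : d' ^ K * n <= E + K.+1 ^ 2 * n ^ K.
  rewrite -eY -(leq_pmul2l n_gt0) mulnDr; apply: leq_trans leY _.
  by rewrite leq_add2l [n ^ K.+1]expnS mulnCA.
have leK : 199 * d ^ K <= 198 * d' ^ K.
  case: K K_gt0 {n_large leY nK_gt0 eX eY leE} => // K _.
  by rewrite !expnS !mulnA leq_mul //; [lia|case: K => // K; rewrite leq_exp2r //; lia].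
(* Since [n <= 3 * d'], the error term can be compared with [n * d' ^ K]. *)
have nK : n ^ K <= 3 ^ K * d' ^ K.
  by rewrite -expnMn leq_exp2r //; lia.
have small : 199 * (K.+1 ^ 2 * n ^ K) < n * d' ^ K.
  apply: (@leq_ltn_trans (199 * K.+1 ^ 2 * 3 ^ K * d' ^ K)).
    by rewrite -!mulnA !leq_mul2l nK !orbT.
  rewrite ltn_pmul2r; last by rewrite expn_gt0; apply/orP; left; lia.
  apply: leq_ltn_trans n_large; rewrite leq_mul2l leq_exp2l //.
  by rewrite leqnSn orbT.
rewrite eX; have : n * (199 * d ^ K) <= n * (198 * d' ^ K) by rewrite leq_mul2l leK orbT.
lia.
Qed.

Lemma regular_degree n (G : sgraph 'I_n) :
  regular G -> exists d, forall x, degree G x = d.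
Proof.
case: n G => [|n] G /forallP regG; first by exists 0 => -[].
by exists (degree G ord0) => x; apply/eqP; move: (regG x) => /forallP.
Qed.

Lemma regular_of_degree n (G : sgraph 'I_n) d :
  (forall x, degree G x = d) -> regular G.
Proof. by move=> degG; apply/forallP => x; apply/forallP => y; rewrite !degG. Qed.

Lemma odd_regular_not_bipartite n (G : sgraph 'I_n) d : odd n -> 0 < d ->
  (forall x, degree G x = d) -> ~ bipartite G.
Proof.
move=> n_odd d_gt0 degG [A bipA].
have := cardsC A; rewrite -(bipartite_regular_half d_gt0 degG bipA) card_ord.
by move=> nE; move: n_odd; rewrite -nE addnn odd_double.
Qed.

Lemma subgraph_of_C5_blowup n (G : sgraph 'I_n)
    (p : 'I_n -> 'I_5) :
  (forall u, exists x, p x = u) ->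
  (forall x y, adj G x y -> adj C5 (p x) (p y)) ->
  exists2 B : sgraph 'I_n, is_blowup C5 B & edges G \subset edges B.
Proof.
move=> surj_p hom_p; exists (graph_of_rel (fun x y => adj C5 (p x) (p y))).
  exists p; split=> // x y; rewrite adj_graph_of_rel [adj _ (p y) _]adjC orbb.
  by case: eqVneq => [->|//]; rewrite adjxx.
apply: edges_subset => x y xy; rewrite adj_graph_of_rel hom_p //.
by rewrite (adj_neq xy).
Qed.

Definition edgeless n : sgraph 'I_n := graph_of_rel (fun _ _ => false).

Lemma adj_edgeless n x y : adj (edgeless n) x y = false.
Proof. by rewrite adj_graph_of_rel andbF. Qed.

Lemma regular_edgeless n : regular (edgeless n).
Proof.
apply: (@regular_of_degree _ _ 0) => x; apply/eqP; rewrite cards_eq0.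
by apply/eqP/setP => y; rewrite !inE adj_edgeless.
Qed.

(** The edgeless graph makes the family nonempty, so the maximum is attained. *)
Lemma ex_rex n (U : finType) (H : sgraph U) :
  exists2 G : sgraph 'I_n, graph_free (complete_graph 3) G && regular G &
    rex n H (complete_graph 3) = ncopies H G.
Proof.
have [|G GP e] := @eq_bigmax_cond _
    [pred G : sgraph 'I_n | graph_free (complete_graph 3) G && regular G]
    (fun G : sgraph 'I_n => ncopies H G); last by exists G.
apply/card_gt0P; exists (edgeless n); apply/andP; split.
  by apply/graph_free_K3P => x y z; rewrite adj_edgeless.
exact: regular_edgeless.
Qed.

Lemma rex_even (U : finType) (H : sgraph U) n : bipartite H -> ~~ odd n ->
  5 * 2 ^ #|U| * #|U| ^ 2 <= n ->
  rex n H (complete_graph 3) = ncopies H (turan2 n).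
Proof.
move=> bipH; rewrite -dvdn2 => /dvdnP[m ->]; rewrite muln2 -addnn => n_large.
apply/eqP; rewrite eqn_leq; apply/andP; split; last first.
  apply: (leq_bigmax_cond (F := fun G => ncopies H G)); apply/andP; split.
    exact/graph_free_K3P/turan2_triangle_free.
  exact/regular_of_degree/degree_turan2.
apply/bigmax_leqP => G /andP[/graph_free_K3P tfG /regular_degree[d degG]].
rewrite leq_ncopies.
case: (boolP [exists a, [exists b, adj H a b]]) => [/existsP[a /existsP[b ab]]|noH].
  have [d_small|d_large] := leqP (5 * d) (2 * (m + m)).
    by apply: embeddings_leq_turan2 ab _ d_small n_large => // x; rewrite degG.
  (* Beyond [2n/5] the graph is bipartite with sides of order [m]; matching these with the sides of
     T(n,2) embeds it there. *)
  have [A bipA] : bipartite G.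
    by apply: (regular_bipartite tfG degG); rewrite card_ord.
  have cA := bipartite_regular_half (ltac:(lia) : 0 < d) degG bipA.
  have := cardsC A; rewrite -cA card_ord => eA.
  have eAm : #|A| = m by lia.
  have cB := card_ord_lt (leq_addr m m).
  have := cardsC [set i : 'I_(m + m) | i < m]; rewrite cB card_ord => /addnI cB'.
  have [||g g_inj gA] := @ex_injection_preserving _ _ A [set i : 'I_(m + m) | i < m].
  - by rewrite cB eAm.
  - by rewrite cB' -cA eAm.
  apply: (leq_embeddings _ g_inj) => x y /bipA; rewrite adj_turan2.
  by rewrite -!gA !inE.
(* Without edges in [H], every injection is an embedding into any host. *)
have noH' x y : ~~ adj H x y.
  by apply: contra noH => xy; apply/existsP; exists x; apply/existsP; exists y.
by rewrite !embeddings_edgeless.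
Qed.

Lemma rex_odd_tree (U : finType) (H : sgraph U) n : tree H -> odd n ->
  1000 <= n -> 199 * #|U| ^ 2 * 3 ^ #|U| < n ->
  exists B Gstar : sgraph 'I_n, is_blowup C5 B /\
    edges Gstar \subset edges B /\ regular Gstar /\
    rex n H (complete_graph 3) = ncopies H Gstar.
Proof.
move=> treeH n_odd n_large n_large'.
have [G /andP[/graph_free_K3P tfG regG] rexG] := ex_rex n H.
have [d degG] := regular_degree regG.
have [U_gt1|U_le1] := ltnP 1 #|U|.
  (* With a smaller degree, [G] would have fewer copies than the graph of [ex_dense_regular]. *)
  have d_large : 99 * #|'I_n| <= 250 * d.
    rewrite leqNgt card_ord; apply/negP => d_small.
    have [G' tfG' [d' degG' d'_large]] := ex_dense_regular n_large.
    suff : ncopies H G < ncopies H G'.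
      rewrite ltnNge -rexG => /negP; apply.
      apply: (leq_bigmax_cond (F := fun G => ncopies H G)).
      by apply/andP; split; [apply/graph_free_K3P | apply: regular_of_degree degG'].
    rewrite ltnNge leq_ncopies -ltnNge.
    by apply: (tree_embeddings_lt treeH U_gt1 _ degG degG'); rewrite ?card_ord.
  have d_gt0 : 0 < d by rewrite card_ord in d_large; lia.
  have nbip := odd_regular_not_bipartite n_odd d_gt0 degG.
  have [|//|[v vC5]] := bipartite_or_C5 tfG degG; first by rewrite card_ord in d_large *; lia.
  have n_gt0 : 0 < #|'I_n| by rewrite card_ord; lia.
  have [p [surj_p hom_p]] := C5_homomorphism tfG degG vC5 n_gt0 d_large.
  have [B blB sGB] := subgraph_of_C5_blowup surj_p hom_p.
  by exists B, G.
(* [H] is a single vertex, so every graph of order [n] has the same number of copies. The edgeless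
   one is placed in the blow-up whose classes are the residues modulo 5. *)
have noH x y : ~~ adj H x y.
  by apply/negP => /adj_neq/eqP; apply; apply: (card_le1_eqP U_le1).
pose p (i : 'I_n) : 'I_5 := inord (i %% 5).
have surj_p u : exists x, p x = u.
  have lt_un : u < n by have := ltn_ord u; lia.
  by exists (Ordinal lt_un); rewrite /p /= modn_small ?inord_val.
have [x y|B blB sEB] := @subgraph_of_C5_blowup n (edgeless n) p surj_p.
  by rewrite adj_edgeless.
exists B, (edgeless n); do 3?split=> //; first exact: regular_edgeless.
rewrite rexG; apply/eqP.
by rewrite eqn_leq !leq_ncopies !embeddings_edgeless // leqnn.
Qed.

Theorem proposition1p7 (U : finType) (H : sgraph U) (hH : bipartite H) :
  (exists n0 : nat, forall n : nat, n0 <= n -> ~~ odd n ->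
     rex n H (complete_graph 3) = ncopies H (turan2 n))
  /\
  (tree H ->
   exists n0 : nat, forall n : nat, n0 <= n -> odd n ->
     exists B Gstar : sgraph 'I_n,
       is_blowup (cycle_graph 5) B /\
       edges Gstar \subset edges B /\
       regular Gstar /\
       rex n H (complete_graph 3) = ncopies H Gstar).
Proof.
split=> [|treeH].
  by exists (5 * 2 ^ #|U| * #|U| ^ 2) => n n_large n_even; apply: rex_even.
exists (maxn 1000 (199 * #|U| ^ 2 * 3 ^ #|U|).+1) => n; rewrite geq_max => /andP[n1 n2] n_odd.
exact: rex_odd_tree.
Qed.
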